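(* Let $p\ge1$ and let $\mathcal{C}\subseteq\mathbb{F}_2^p$ be a (not necessarily linear, nonempty) code of length $p$ over $\mathbb{F}_2$, with generalized covering radii $R_\theta$, $\theta\ge1$. Let $\hat{c}=|\hat{\mathcal{C}}|$, where $\hat{\mathcal{C}}\subseteq\mathcal{C}$ contains exactly one of $\{\mathbf{c},\mathbf{c}\oplus\mathbf{1}\}$ for every $\mathbf{c}\in\mathcal{C}$. Then for every finite set $\mathcal{A}\subset\mathbb{R}$ the pair $\left(\frac{p+\hat{c}}{p},\frac{R_{C(\mathcal{A})}+C(\mathcal{A})}{p}\right)$ is $\mathcal{A}$-feasible, using the same encoding scheme for all finite sets $\mathcal{A}\subset\mathbb{R}$ (i.e., a single infinite sequence of encodings, not depending on $\mathcal{A}$, works for every $\mathcal{A}$). Moreover, the encoding scheme is systematic, i.e., each encoding stores, for every $i\in[k]$, the entry $x_i$ in uncoded form at some server.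
   Context: Protocols. Let $\mathcal{A}\subset\mathbb{R}$ be finite. An $\mathcal{A}$-protocol with parameters $(k,n,\ell)$ (positive integers, $n\ge k$) consists of a linear encoding $\mathbb{R}^k\to\mathbb{R}^n$, $\mathbf{x}\mapsto\mathbf{y}=(y_1,\dots,y_n)$ (each $y_i$ is a fixed linear combination of the entries of $\mathbf{x}$ and is stored on server $i$), together with, for every $\mathbf{w}\in\mathcal{A}^k$, a set $S_{\mathbf{w}}\subseteq[n]$ of at most $\ell$ servers (depending only on $\mathbf{w}$) and a decoding function that for every $\mathbf{x}\in\mathbb{R}^k$ computes $\mathbf{w}\mathbf{x}^\intercal$ from $(y_i)_{i\in S_{\mathbf{w}}}$. Feasibility. A pair $(\alpha,\beta)\in\mathbb{R}^2$ is $\mathcal{A}$-feasible if there is an infinite family of $\mathcal{A}$-protocols with parameters $\{(k_i,n_i,\ell_i)\}_{i\ge0}$, with $k_i$ strictly increasing, such that $\lim_{i\to\infty}(n_i/k_i,\ell_i/k_i)=(\alpha,\beta)$. Complexity. For a finite set $\mathcal{A}\subset\mathbb{R}$, the complexity $C(\mathcal{A})$ is the smallest positive integer $\theta$ for which there exist (not necessarily distinct) real numbers $x_1,\dots,x_\theta,y_1,\dots,y_\theta$ with $\mathcal{A}\subseteq\{x_1,y_1\}+\cdots+\{x_\theta,y_\theta\}$, where $+$ denotes the sumset $\mathcal{S}+\mathcal{T}=\{s+t\mid s\in\mathcal{S},t\in\mathcal{T}\}$. Codes. For $\theta\in\{1,2,\dots\}$, the $\theta$-th generalized covering radius $R_\theta$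 of $\mathcal{C}\subseteq\mathbb{F}_2^p$ is the smallest integer $s$ such that for every $\mathbf{v}_1,\dots,\mathbf{v}_\theta\in\mathbb{F}_2^p$ there exist codewords $\mathbf{c}_1,\dots,\mathbf{c}_\theta\in\mathcal{C}$ with $\left|\bigcup_{i=1}^{\theta}\operatorname{supp}(\mathbf{v}_i-\mathbf{c}_i)\right|\le s$, where $\operatorname{supp}$ denotes the set of indices of nonzero entries. $\oplus$ is addition in $\mathbb{F}_2^p$ and $\mathbf{1}$ is the all-ones vector. In the definition of $\hat{\mathcal{C}}$: if both $\mathbf{c}$ and $\mathbf{c}\oplus\mathbf{1}$ lie in $\mathcal{C}$, exactly one of them is in $\hat{\mathcal{C}}$; if $\mathbf{c}\in\mathcal{C}$ but $\mathbf{c}\oplus\mathbf{1}\notin\mathcal{C}$, then $\mathbf{c}\in\hat{\mathcal{C}}$. The size of $\hat{\mathcal{C}}$ does not depend on the choices made. *)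

(* Defs.v *)
(* MathComp / MathComp-Analysis *)
From HB Require Import structures.
From mathcomp Require Import all_boot all_order all_algebra.
From mathcomp Require Import all_classical all_reals all_analysis.
Set Implicit Arguments.
Unset Strict Implicit.
Unset Printing Implicit Defensive.
Import Order.TTheory GRing.Theory Num.Theory.
Import numFieldNormedType.Exports.
Local Open Scope classical_set_scope.
Local Open Scope ring_scope.

(* Junk value 0 if [P] is empty; the lemmas [complexity_least] and
   [cov_radius_least] rule this case out for the two uses below. *)
Definition is_least (P : set nat) (m : nat) : Prop :=
  P m /\ forall m', P m' -> (m <= m')%N.

Definition least (P : set nat) : nat := xget 0%N (is_least P).

Lemma leastP (P : set nat) : P !=set0 -> is_least P (least P).
Proof.
move=> [m Pm]; have ex : exists m, `[< P m >] by exists m; apply/asboolP.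
suff Q : is_least P (ex_minn ex) by exact: (xgetPex 0%N (ex_intro _ _ Q)).
case: ex_minnP => s /asboolP Ps smin; split=> // m' /asboolP; exact: smin.
Qed.

Section Protocols.
Variable R : realType.

Definition coeffs_in (A : set R) (k : nat) (w : 'rV[R]_k) : Prop :=
  forall i, A (w 0 i).

(* Server [j] stores [(x *m enc) 0 j].  The decoding function receives exactly
   the family of symbols stored on the servers of [access w]; the values of
   [access] and [dec] at vectors [w] outside A^k are irrelevant. *)
Record protocol (A : set R) (k n l : nat) : Type := Protocol {
  protocol_k_gt0 : (0 < k)%N;
  protocol_k_le_n : (k <= n)%N;
  protocol_l_gt0 : (0 < l)%N;
  enc : 'M[R]_(k, n);
  access : 'rV[R]_k -> {set 'I_n};
  dec : forall w : 'rV[R]_k, ({j : 'I_n | j \in access w} -> R) -> R;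
  card_access : forall w, coeffs_in A w -> (#|access w| <= l)%N;
  dec_correct : forall w, coeffs_in A w -> forall x : 'rV[R]_k,
    dec (fun j : {j | j \in access w} => (x *m enc) 0 (val j))
    = (w *m x^T) 0 0
}.

Record encoding_scheme : Type := EncodingScheme {
  msg_len : nat -> nat;
  servers : nat -> nat;
  encoding : forall i, 'M[R]_(msg_len i, servers i)
}.

Definition feasible_with (E : encoding_scheme) (A : set R) (ab : R * R) : Prop :=
  exists (l : nat -> nat)
         (P : forall i, protocol A (msg_len E i) (servers E i) (l i)),
    [/\ forall i, enc (P i) = encoding E i,
        {homo msg_len E : i j / (i < j)%N} &
        (fun i => ((servers E i)%:R / (msg_len E i)%:R,
                   (l i)%:R / (msg_len E i)%:R) : R * R) @ \oo --> ab].

Definition feasible (A : set R) (ab : R * R) : Prop :=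
  exists E : encoding_scheme, feasible_with E A ab.

Definition systematic (k n : nat) (G : 'M[R]_(k, n)) : Prop :=
  forall i : 'I_k, exists j : 'I_n, forall x : 'rV[R]_k, (x *m G) 0 j = x 0 i.

Definition sumset (S T : set R) : set R := [set s + t | s in S & t in T].

Definition sum_of_pairs (A : set R) (theta : nat) : Prop :=
  exists x y : 'I_theta -> R,
    A `<=` \big[sumset/[set 0]]_(i < theta) [set x i; y i].

Definition complexity (A : set R) : nat :=
  least [set theta | (0 < theta)%N /\ sum_of_pairs A theta].

Lemma complexity_least (A : set R) : finite_set A ->
  is_least [set theta | (0 < theta)%N /\ sum_of_pairs A theta] (complexity A).
Proof.
move=> /finite_seqP[s ->]; apply: leastP; exists (size s).+1; split=> //.
exists (fun i : 'I_(size s).+1 => nth 0 s i), (fun=> 0) => a /= sa.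
have mem (z : 'I_(size s).+1 -> R) : (forall i : 'I_(size s).+1, [set nth 0 s i; 0] (z i)) ->
    (\big[sumset/[set 0]]_(i < (size s).+1) [set nth 0 s i; 0]) (\sum_i z i).
  move=> h; apply: (big_ind2 (fun (S : set R) z => S z)) => //.
  by move=> S u T v Su Tv; exists u => //; exists v.
have ks : (index a s < (size s).+1)%N by rewrite ltnS index_size.
have := mem (fun i => if i == Ordinal ks then a else 0).
rewrite -big_mkcond big_pred1_eq; apply => i.
by case: eqP => [->|_]; [left; rewrite nth_index | right].
Qed.

End Protocols.

Section Codes.
Variable p : nat.
Implicit Types (C : {set 'rV['F_2]_p}) (v : 'rV['F_2]_p).

Definition supp v : {set 'I_p} := [set j | v 0 j != 0]%SET.

Definition covers C (theta s : nat) : Prop :=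
  forall v : 'I_theta -> 'rV['F_2]_p,
  exists2 c : 'I_theta -> 'rV['F_2]_p, (forall i, c i \in C) &
    (#|\bigcup_(i < theta) supp (v i - c i)|%SET <= s)%N.

Definition cov_radius C (theta : nat) : nat := least (covers C theta).

Lemma cov_radius_least C theta : C != finset.set0 ->
  is_least (covers C theta) (cov_radius C theta).
Proof.
move=> /set0Pn[c Cc]; apply: leastP; exists p => v; exists (fun=> c) => //.
by rewrite -[leqRHS]card_ord max_card.
Qed.

(* If c + 1 is not in C, the inclusion [Chat \subset C] forces c into Chat. *)
Definition mod_complement C (Chat : {set 'rV['F_2]_p}) : Prop :=
  Chat \subset C /\
  forall c, c \in C -> (c \in Chat) (+) (c + const_mx 1 \in Chat).

End Codes.

(* Main.v *)
Require Import Defs.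
From HB Require Import structures.
From mathcomp Require Import all_boot all_order all_algebra.
From mathcomp Require Import all_classical all_reals all_analysis.
From mathcomp Require Import ring.
Set Implicit Arguments.
Unset Strict Implicit.
Unset Printing Implicit Defensive.
Import Order.TTheory GRing.Theory Num.Theory.
Import numFieldNormedType.Exports.
Local Open Scope classical_set_scope.
Local Open Scope ring_scope.

(** Cut [x] into [m] blocks of length [p] and store the entries of [x], the
    products of every block with the sign vectors of [Chat], and the sum of all
    entries of [x]. A vector with entries in [{a, b}] equals
    [(a + b) / 2 + (a - b) / 2 * v] for some sign vector [v], so a vector over
    [A] is a constant, the same in all blocks, plus a combination of
    [theta = complexity A] sign vectors. In each block, replace these by [theta]
    codewords that jointly cover them: this costs [theta] coded symbols and the
    entries at the at most [cov_radius C theta] positions of disagreement, and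
    the constants cost one extra symbol overall, which vanishes in the limit. *)

(** If [G *m u = w^T], then [x *m G *m u] is the wanted product, so a linear decoder with weights
    [u] needs only the servers where [u] is nonzero. *)
Lemma protocol_of_sparse_columns (R : realType) (A : set R) (k n l : nat)
    (G : 'M[R]_(k, n)) :
  (0 < k)%N -> (k <= n)%N -> (0 < l)%N ->
  (forall w : 'rV[R]_k, coeffs_in A w -> exists2 u : 'cV[R]_n,
     G *m u = w^T & (#|[set j | u j 0%R != 0%R]%SET| <= l)%N) ->
  exists P : protocol A k n l, enc P = G.
Proof.
move=> k0 kn l0 sparse.
have /choice[u uP] : forall w : 'rV[R]_k, exists u : 'cV[R]_n, coeffs_in A w ->
    G *m u = w^T /\ (#|[set j | u j 0%R != 0%R]%SET| <= l)%N.
  move=> w.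
  (* Outside [A^k] the value [0] is a mere default. *)
  have [Aw|nAw] := pselect (coeffs_in A w); last by exists 0.
  by have [u Gu ul] := sparse w Aw; exists u.
pose acc (w : 'rV[R]_k) : {set 'I_n} := [set j | u w j 0%R != 0%R]%SET.
pose dc w (f : {j : 'I_n | j \in acc w} -> R) : R :=
  \sum_(j : {j : 'I_n | j \in acc w}) f j * u w (val j) 0.
have card_acc w : coeffs_in A w -> (#|acc w| <= l)%N by move=> /uP[].
suff dcP w : coeffs_in A w -> forall x : 'rV[R]_k,
    dc w (fun j => (x *m G) 0 (val j)) = (w *m x^T) 0 0.
  by exists (Protocol k0 kn l0 card_acc dcP).
move=> /uP[Gu _] x; rewrite /dc.
rewrite -[w *m _]trmxK trmx_mul trmxK -Gu mulmxA [RHS]mxE [RHS]mxE.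
rewrite [RHS](bigID (mem (acc w))) /= [X in _ = _ + X]big1 ?addr0; last first.
  by move=> j; rewrite inE negbK => /eqP->; rewrite mulr0.
by rewrite [RHS](big_sub (acc w)).
Qed.

Lemma mem_sumset_big (R : realType) (n : nat) (S : 'I_n -> set R) (a : R) :
  (\big[@sumset R/[set 0]]_(i < n) S i) a ->
  exists2 z : 'I_n -> R, (forall i, S i (z i)) & a = \sum_i z i.
Proof.
elim: n S a => [|n IH] S a.
  by rewrite big_ord0 => ->; exists (fun=> 0) => [[]//|]; rewrite big_ord0.
rewrite big_ord_recl => -[s Ss [t /IH[z Sz ->] <-]].
exists (fun i => oapp z s (unlift ord0 i)) => [i|].
  by case: unliftP => [j ->|->] //=.
rewrite big_ord_recl unlift_none /=; congr (_ + _).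
by apply: eq_bigr => i _; rewrite liftK.
Qed.

Lemma leq_sum_ord (n c : nat) (f : 'I_n -> nat) :
  (forall i, (f i <= c)%N) -> (\sum_i f i <= n * c)%N.
Proof.
move=> fc; apply: (@leq_trans (\sum_(i < n) c)); first exact: leq_sum.
by rewrite sum_nat_const card_ord.
Qed.

Section Sign.
Variable R : realType.

Definition sgF2 (a : 'F_2) : R := if a == 0 then 1 else -1.

Lemma sgF2D1 (a : 'F_2) : sgF2 (a + 1) = - sgF2 a.
Proof.
by case: a => -[|[|//]] i; rewrite /sgF2 //= ?opprK.
Qed.

(** Complementing a codeword negates its sign vector, so one server serves both, with [e] equal to 1
    or -1. *)
Lemma mod_complement_sign (p : nat) (C Chat : {set 'rV['F_2]_p}) c :
  mod_complement C Chat -> c \in C ->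
  exists (d : {d | d \in Chat}) (e : R),
    forall j, sgF2 (c 0 j) = e * sgF2 (val d 0 j).
Proof.
move=> [_ /[apply]]; case: (boolP (c \in Chat)) => [cC _|_ /= cC].
  by exists (exist (fun d => is_true (d \in Chat)) c cC), 1 => j; rewrite mul1r.
exists (exist (fun d => is_true (d \in Chat)) _ cC), (-1) => j /=.
by rewrite !mxE sgF2D1 mulN1r opprK.
Qed.

End Sign.

Section Encoding.
Variables (R : realType) (p : nat) (Chat : {set 'rV['F_2]_p}) (m : nat).

Notation I := ('I_m * 'I_p)%type.
Notation J := ((I + 'I_m * {c | c \in Chat}) + unit)%type.

(* [i] indexes an entry of the message and [j] a server: an uncoded entry, a
   block paired with a codeword, or the sum of all entries. *)
Definition coef (i : I) (j : J) : R :=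
  match j with
  | inl (inl i') => (i == i')%:R
  | inl (inr (b, c)) => (i.1 == b)%:R * sgF2 R (val c 0 i.2)
  | inr _ => 1
  end.

Definition block_encoding : 'M[R]_(#|{: I}|, #|{: J}|) :=
  \matrix_(i, j) coef (enum_val i) (enum_val j).

Lemma block_encoding_systematic : systematic block_encoding.
Proof.
move=> i; exists (enum_rank (inl (inl (enum_val i)))) => x.
rewrite mxE (bigD1 i) //= big1 ?addr0 => [|i' i'i]; rewrite mxE enum_rankK /=.
  by rewrite eqxx mulr1.
by rewrite (inj_eq enum_val_inj) (negPf i'i) mulr0.
Qed.

Lemma card_msg : #|{: I}| = (m * p)%N.
Proof. by rewrite card_prod !card_ord. Qed.

Lemma card_servers : #|{: J}| = (m * (p + #|Chat|) + 1)%N.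
Proof.
by rewrite !card_sum card_unit !card_prod !card_ord card_sig mulnDr.
Qed.

(** Generic in [op] in order to split both the decoding sum in [R] and the count of accessed servers
    in [nat]. *)
Lemma big_servers (T : Type) (idx : T) (op : Monoid.com_law idx) (f : J -> T) :
  \big[op/idx]_j f j =
  op (op (\big[op/idx]_b \big[op/idx]_i f (inl (inl (b, i))))
         (\big[op/idx]_b \big[op/idx]_d f (inl (inr (b, d)))))
     (f (inr tt)).
Proof.
rewrite !big_sumType /= !pair_bigA /= (big_pred1 tt) => [|[]//].
by congr (op (op _ _) _); apply: eq_bigr => -[].
Qed.

Lemma sparse_coef (C : {set 'rV['F_2]_p}) (A : set R) (theta s : nat) (w : I -> R) :
  mod_complement C Chat -> sum_of_pairs A theta -> covers C theta s ->
  (forall i, A (w i)) ->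
  exists2 u : J -> R, forall i, \sum_j coef i j * u j = w i &
    (\sum_j (u j != 0%R) <= m * (s + theta) + 1)%N.
Proof.
move=> hC [x [y Axy]] cov Aw.
pose hs t := (x t + y t) / 2; pose hd t := (x t - y t) / 2.
have /choice[v vP] : forall i, exists v : 'I_theta -> 'F_2,
    w i = \sum_t (hs t + hd t * sgF2 R (v t)).
  move=> i; have [z zP ->] := mem_sumset_big (Axy _ (Aw i)).
  exists (fun t => if z t == x t then 0 else 1); apply: eq_bigr => t _.
  rewrite /hs /hd; case: eqP => [->|zx]; rewrite /sgF2 ?eqxx ?oner_eq0 /=.
    by field.
  by case: (zP t) => // ->; field.
pose bv b t : 'rV['F_2]_p := \row_j v (b, j) t.
have /choice[c cP] : forall b, exists c : 'I_theta -> 'rV['F_2]_p,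
    (forall t, c t \in C) /\
    (#|\bigcup_(t < theta) supp (bv b t - c t)|%SET <= s)%N.
  by move=> b; have [c cC cs] := cov (bv b); exists c.
have /choice[de deP] : forall bt, exists de : {d | d \in Chat} * R,
    forall j, sgF2 R (c bt.1 bt.2 0 j) = de.2 * sgF2 R (val de.1 0 j).
  move=> bt; have [d [e h]] := mod_complement_sign R hC ((cP bt.1).1 bt.2).
  by exists (d, e).
(* An uncoded entry corrects the error of the codewords at its position. A coded server gathers the
   weights of all [t] that it represents, as several may share it. *)
pose u (j : J) : R := match j with
  | inl (inl (b, i)) => \sum_t hd t * (sgF2 R (bv b t 0 i) - sgF2 R (c b t 0 i))
  | inl (inr (b, d)) => \sum_t (d == (de (b, t)).1)%:R * (hd t * (de (b, t)).2)
  | inr _ => \sum_t hs t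
  end.
exists u => [[b i]|]; rewrite big_servers.
  rewrite (bigD1 b) //= (bigD1 i) //= eqxx mul1r.
  rewrite [X in _ + X + _ + _ + _]big1 => [|i' i'i]; last first.
    by rewrite xpair_eqE [i == _]eq_sym (negPf i'i) andbF mul0r.
  rewrite [X in _ + X + _ + _]big1 => [|b' b'b]; last first.
    by apply: big1 => i' _; rewrite xpair_eqE eq_sym (negPf b'b) mul0r.
  rewrite (bigD1 b) //= [X in _ + (_ + X) + _]big1 => [|b' b'b]; last first.
    by apply: big1 => d _; rewrite eq_sym (negPf b'b) !mul0r.
  rewrite !addr0 mul1r eqxx.
  under [X in _ + X + _]eq_bigr do rewrite mul1r mulr_sumr.
  (* The identity now holds for each [t] separately: the codeword terms cancel. *)
  rewrite exchange_big /= -!big_split vP /=; apply: eq_bigr => t _.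
  rewrite (bigD1 (de (b, t)).1) //= eqxx big1 => [|d /negPf->]; last by rewrite mul0r mulr0.
  by rewrite (deP (b, t)) /= !mxE; ring.
rewrite leq_add ?leq_b1 // mulnDr leq_add //.
  apply: leq_sum_ord => b.
  apply: leq_trans (cP b).2; rewrite -sum1_card [leqRHS]big_mkcond /=.
  apply: leq_sum => i _; case: ifP => [_|/negbT ni]; first exact: leq_b1.
  (* Outside the union of supports every correction vanishes. *)
  rewrite big1 ?eqxx // => t _; suff -> : bv b t 0 i = c b t 0 i by rewrite subrr mulr0.
  apply/eqP; rewrite -subr_eq0; apply: contraNT ni => bc.
  by apply/bigcupP; exists t; rewrite // !inE !mxE in bc *.
apply: leq_sum_ord => b.
(* A nonzero weight at [d] requires some [t] represented by [d], and each [t] has a single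
   representative. *)
apply: (@leq_trans (\sum_d \sum_(t < theta) (d == (de (b, t)).1))).
  apply: leq_sum => d _; case: eqVneq => //= nz.
  rewrite lt0n sum_nat_eq0 negb_forall; apply: contraNT nz.
  rewrite negb_exists => /forallP h; rewrite big1 // => t _.
  by have := h t; rewrite implyTb negbK eqb0 => /negPf->; rewrite mul0r.
rewrite exchange_big -[theta in leqRHS]muln1; apply: leq_sum_ord => t.
by rewrite (bigD1 (de (b, t)).1) //= eqxx big1 // => d /negPf->.
Qed.

Lemma block_protocol (C : {set 'rV['F_2]_p}) (A : set R) (theta s : nat) :
  (0 < m)%N -> (0 < p)%N ->
  mod_complement C Chat -> sum_of_pairs A theta -> covers C theta s ->
  exists P : protocol A #|{: I}| #|{: J}| (m * (s + theta) + 1),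
    enc P = block_encoding.
Proof.
move=> m0 p0 hC sA cov; apply: protocol_of_sparse_columns.
- by rewrite card_msg muln_gt0 m0.
- by rewrite card_msg card_servers mulnDr -addnA leq_addr.
- by rewrite addn1.
move=> w Aw.
have [u uw us] := sparse_coef hC sA cov (fun i => Aw (enum_rank i)).
exists (\col_j u (enum_val j)).
  apply/colP => i; rewrite !mxE -[i in RHS]enum_valK -uw.
  (* Pass from structured server indices to ordinals. *)
  rewrite [RHS](reindex_onto enum_val enum_rank) => [|j _]; last exact: enum_rankK.
  apply: eq_big => [j|j _]; first by rewrite enum_valK eqxx.
  by rewrite !mxE.
apply: leq_trans us; rewrite -sum1_card big_mkcond /=.
rewrite [leqRHS](reindex_onto enum_val enum_rank) => [|j _]; last exact: enum_rankK.
rewrite [leqRHS](eq_bigl xpredT) => [|j]; last by rewrite enum_valK eqxx.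
by apply: leq_sum => j _; rewrite inE mxE; case: eqP.
Qed.

End Encoding.

(** The one extra symbol contributes exactly [harmonic i / p], which tends to 0. *)
Lemma cvg_affine_ratio (R : realType) (a p : nat) : (0 < p)%N ->
  (fun i => (i.+1 * a + 1)%:R / (i.+1 * p)%:R : R) @ \oo --> (a%:R / p%:R : R).
Proof.
move=> p0; have p0' : p%:R != 0 :> R by rewrite pnatr_eq0 -lt0n.
under eq_fun => i.
  have -> : (i.+1 * a + 1)%:R / (i.+1 * p)%:R = a%:R / p%:R + harmonic i / p%:R :> R.
    rewrite natrD !natrM /harmonic /=; field.
    by rewrite p0' /= ?nat1r pnatr_eq0.
  over.
have := cvgD (cvg_cst (a%:R / p%:R : R)) (cvgMl (b := p%:R^-1) (@cvg_harmonic R)).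
by rewrite mul0r addr0; apply.
Qed.

Theorem theorem5 (R : realType) (p : nat) (C Chat : {set 'rV['F_2]_p})
    (p_gt0 : (0 < p)%N) (C_neq0 : C != finset.set0)
    (hChat : mod_complement C Chat) :
  exists E : encoding_scheme R,
    (forall i, systematic (encoding E i)) /\
    forall A : set R, finite_set A ->
      feasible_with E A
        ((p + #|Chat|)%N%:R / p%:R,
         (cov_radius C (complexity A) + complexity A)%N%:R / p%:R).
Proof.
(* Chosen before [A]; taking [i.+1] blocks keeps every message nonempty. *)
exists (EncodingScheme (fun i => block_encoding R Chat i.+1)); split.
  by move=> i; exact: block_encoding_systematic.
move=> A /complexity_least[[_ sA] _].
have [cov _] := cov_radius_least (complexity A) C_neq0.
pose P i := cid (block_protocol (ltn0Sn i) p_gt0 hChat sA cov).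
exists _, (fun i => projT1 (P i)); split => [i|i j ij|] /=.
- exact: projT2 (P i).
- by rewrite !card_msg ltn_mul2r p_gt0 ltnS.
under eq_fun do rewrite card_servers card_msg.
exact: cvg_pair (cvg_affine_ratio p_gt0) (cvg_affine_ratio p_gt0).
Qed.
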